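(* For every integer $d\geqslant 3$ there exist constants $c_d,\tau_d,B_d>0$, depending only on $d$, such that the following holds. For every integer $N\geqslant 3$ there is a metric space $\mathcal{M}=(M,\varrho)$ with $|M|=N$ such that for every integer $n\geqslant d$ with $dn$ even, $$\mathbb{P}_{G(n,d)}\Big[G\colon\gamma(G,\varrho)\geqslant c_d\min\big\{\log n,\ \log\log N\big\}\Big]\geqslant 1-\frac{B_d}{n^{\tau_d}}.$$
   Context: $G(n,d)$ denotes the set of all $d$-regular (simple) graphs on $[n]:=\{1,\dots,n\}$ and $\mathbb{P}_{G(n,d)}$ the uniform probability measure on $G(n,d)$; statements about $\mathbb{P}_{G(n,d)}$ are understood for those $n$ for which $G(n,d)\neq\emptyset$. $\log$ is the natural logarithm. For a $d$-regular graph $G$ with vertex set $V_G$ and edge set $E_G$, and a metric space $\mathcal{M}=(M,\varrho)$, $\gamma(G,\varrho)$ denotes the smallest constant $\gamma\in(0,\infty]$ such that for every $f\colon V_G\to M$, $$\frac{1}{|V_G|^2}\sum_{v,u\in V_G}\varrho\big(f(v),f(u)\big)\leqslant\frac{\gamma}{|E_G|}\sum_{\{v,u\}\in E_G}\varrho\big(f(v),f(u)\big),$$ where the left-hand sum is over all ordered pairs $(v,u)$. *)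

(* Defs.v *)
From HB Require Import structures.
From mathcomp Require Import all_boot all_order all_algebra.
From mathcomp Require Import all_classical all_reals all_analysis.

Set Implicit Arguments.
Unset Strict Implicit.
Unset Printing Implicit Defensive.

Import Order.TTheory GRing.Theory Num.Theory.

Local Open Scope ring_scope.

(* A simple graph on [n], modelled as 'I_n, is given by its set of edges,
   each edge being a 2-element set of vertices. *)
Definition graph (n : nat) := {set {set 'I_n}}.

Definition simple n (G : graph n) : bool := [forall e in G, #|e| == 2%N].

Definition degree n (G : graph n) (v : 'I_n) : nat :=
  #|[set e in G | v \in e]%SET|.

Definition regular n (d : nat) (G : graph n) : bool :=
  [forall v, degree G v == d].

Definition regular_graphs (n d : nat) : {set graph n} :=
  [set G : graph n | simple G && regular d G]%SET.

Definition regular_graph_prob (R : realType) (n d : nat)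
    (A : {set graph n}) : R :=
  #|A :&: regular_graphs n d|%:R / #|regular_graphs n d|%:R.

Section poincare.
Context {R : realType} {n : nat}.
Implicit Types (G : graph n) (M : metricType R).

Definition mean_dist M (f : 'I_n -> M) : R :=
  (n%:R ^+ 2)^-1 * \sum_(v < n) \sum_(u < n) mdist (f v) (f u).

(* The condition v < u makes every edge {v, u} contribute exactly once. *)
Definition edge_dist_sum G M (f : 'I_n -> M) : R :=
  \sum_(p : 'I_n * 'I_n | (p.1 < p.2)%N && ([set p.1; p.2]%SET \in G))
    mdist (f p.1) (f p.2).

Definition poincare_ineq G M (g : R) : Prop :=
  forall f : 'I_n -> M, mean_dist f <= g / #|G|%:R * edge_dist_sum G f.

(* The value is +oo exactly when no finite constant is admissible.  As soon as
   there are two vertices and two points in M, a finite value is attained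
   (poincare_gamma_min), hence it is the smallest admissible constant. *)
Definition poincare_gamma G M : \bar R :=
  ereal_inf [set g%:E | g in [set g : R | 0 < g /\ poincare_ineq G M g]].

End poincare.

Lemma poincare_gamma_min (R : realType) (n : nat) (G : graph n) (M : metricType R)
    (g : R) :
  (1 < n)%N -> (exists x y : M, x <> y) ->
  poincare_gamma G M = g%:E -> 0 < g /\ poincare_ineq G M g.
Proof.
move=> n1 [x [y xy]] gE.
have edge0 (f : 'I_n -> M) : 0 <= edge_dist_sum G f.
  by apply: sumr_ge0 => p _; exact: mdist_ge0.
have ineq : poincare_ineq G M g.
  move=> f; rewrite leNgt; apply/negP => lt_f.
  set b := #|G|%:R^-1 * edge_dist_sum G f.
  have b0 : 0 <= b by rewrite mulr_ge0// invr_ge0.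
  have gb : g * b < mean_dist f by rewrite /b mulrA.
  pose e := (mean_dist f - g * b) / (b + 1).
  have b1 : 0 < b + 1 by rewrite ltr_wpDl.
  have e0 : 0 < e by rewrite divr_gt0// subr_gt0.
  have : (ereal_inf [set g%:E | g in
      [set g : R | (0 < g)%R /\ poincare_ineq G M g]] < (g + e)%:E)%E.
    by rewrite -/(poincare_gamma G M) gE lte_fin ltrDl.
  move=> /ereal_inf_lt[_ [h [h0 hM] <-]]; rewrite lte_fin => hge.
  have fh : mean_dist f <= (g + e) * b.
    by rewrite (le_trans (hM f))// -mulrA -/b ler_wpM2r// ltW.
  have eb : e * (b + 1) = mean_dist f - g * b by rewrite /e divfK// gt_eqF.
  have : e * b < mean_dist f - g * b by rewrite -eb mulrDr mulr1 ltrDl.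
  by rewrite ltrBrDl -mulrDl ltNge fh.
split=> //.
pose i0 : 'I_n := Ordinal (ltnW n1).
pose i1 : 'I_n := Ordinal n1.
pose f (i : 'I_n) := if i == i0 then x else y.
have f0 : 0 < mean_dist f.
  rewrite mulr_gt0 ?invr_gt0 ?exprn_gt0 ?ltr0n ?(ltnW n1)//.
  rewrite (bigD1 i0)//= ltr_pwDl//.
    rewrite (bigD1 i1)//= ltr_pwDl//.
      by rewrite /f eqxx/= mdist_gt0; apply/eqP.
    by apply: sumr_ge0 => u _; exact: mdist_ge0.
  by apply: sumr_ge0 => v _; apply: sumr_ge0 => u _; exact: mdist_ge0.
rewrite ltNge; apply/negP => g0.
have := lt_le_trans f0 (ineq f); rewrite -mulrA ltNge => /negP; apply.
by rewrite mulr_le0_ge0// mulr_ge0// invr_ge0.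
Qed.

(* Main.v *)
Require Import Defs.
From HB Require Import structures.
From mathcomp Require Import all_boot all_order all_algebra.
From mathcomp Require Import all_classical all_reals all_analysis.
From mathcomp Require Import zify ring lra.

Import Order.TTheory GRing.Theory Num.Theory.

Local Open Scope ring_scope.

(** The lower bound holds for every [d]-regular graph [G].  Put [K = d + 1] and
    let [M] be the grid [{0, ..., L}^k] with the sup metric, where [k = 4 K^L];
    it has [N] points (up to padding) when [log log N] is of order [L].  Split
    the vertices into [k] classes [S_i] of nearly equal size, and map [v] to the
    vector of truncated distances [min(l, d_G(v, S_i))], where [l <= L] and
    [4 K^l <= n].  This map is 1-Lipschitz.  A ball of radius [l] around a class
    contains at most [(n/k + 1) K^l <= n/2] vertices, so [v] in [S_i] is mapped
    at distance [l] from the image of at least half of the vertices.  Hence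
    [gamma >= l/4].  When [L = 0] the target bound is a constant, and mapping the
    vertices evenly to two points of a discrete space suffices; when [n < 4 K]
    the claimed probability is nonpositive for [B = 4 K]. *)

(** * Finite metric spaces given by natural-number coordinates *)

Section padded_sup_metric.
Local Open Scope nat_scope.
Context {N k : nat} (phi : 'I_N -> 'I_k -> nat).

(* Distinct points are kept at distance at least 1, so that [phi] need not be
   injective. *)
Definition sup_distn (x y : 'I_N) : nat :=
  if x == y then 0 else
  maxn 1 (\max_(i < k) ((phi x i - phi y i) + (phi y i - phi x i))).

Lemma sup_distnxx x : sup_distn x x = 0.
Proof. by rewrite /sup_distn eqxx. Qed.

Lemma sup_distn_eq0 x y : sup_distn x y = 0 -> x = y.
Proof. by rewrite /sup_distn; case: eqP => // _; lia. Qed.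

Lemma sup_distnC x y : sup_distn x y = sup_distn y x.
Proof.
rewrite /sup_distn eq_sym; case: eqP => // _; congr maxn.
by apply: eq_bigr => i _; rewrite addnC.
Qed.

Lemma leq_sup_distn x y i :
  (phi x i - phi y i) + (phi y i - phi x i) <= sup_distn x y.
Proof.
rewrite /sup_distn; case: eqP => [->|_]; first by lia.
by rewrite leq_max (leq_bigmax_cond i) ?orbT.
Qed.

Lemma sup_distn_triangle y x z :
  sup_distn x z <= sup_distn x y + sup_distn y z.
Proof.
have [->|/eqP xz] := eqVneq x y; first by rewrite sup_distnxx.
have pos : 0 < sup_distn x y by case: posnP => // /sup_distn_eq0.
rewrite {1}/sup_distn; case: eqP => // _.
rewrite geq_max; apply/andP; split; first by lia.
apply/bigmax_leqP => i _.
have := leq_sup_distn x y i; have := leq_sup_distn y z i; lia.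
Qed.

Lemma sup_distn_le1 x y :
  (forall i, (phi x i - phi y i) + (phi y i - phi x i) <= 1) ->
  sup_distn x y <= 1.
Proof.
move=> h; rewrite /sup_distn; case: eqP => // _; rewrite geq_max /=.
exact/bigmax_leqP.
Qed.

Lemma sup_distn_gt0 x y : x != y -> 0 < sup_distn x y.
Proof. by move=> /negbTE xy; rewrite /sup_distn xy leq_max. Qed.

End padded_sup_metric.

(** The alias carries [R] and [phi] in the type, so that each [phi] gets its own metric instance. *)
Definition padded_space (R : realType) (N k : nat) (phi : 'I_N -> 'I_k -> nat)
  : Type := 'I_N.

Section padded_space_metric.
Context {R : realType} {N k : nat} (phi : 'I_N -> 'I_k -> nat).
Notation T := (padded_space R N k phi).

HB.instance Definition _ := Choice.copy T 'I_N.

Let dist (x y : T) : R := (sup_distn phi x y)%:R.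

Let distxx x : dist x x = 0.
Proof. by rewrite /dist sup_distnxx. Qed.

Let dist_eq0 x y : dist x y = 0 -> x = y.
Proof. by move/eqP; rewrite pnatr_eq0 => /eqP/sup_distn_eq0. Qed.

Let dist_sym x y : dist x y = dist y x.
Proof. by rewrite /dist sup_distnC. Qed.

Let dist_triangle y x z : dist x z <= dist x y + dist y z.
Proof. by rewrite /dist -natrD ler_nat sup_distn_triangle. Qed.

HB.instance Definition _ :=
  isMetric.Build R T distxx dist_eq0 dist_sym dist_triangle.

Lemma mdist_padded (x y : T) : mdist x y = (sup_distn phi x y)%:R.
Proof. by []. Qed.

End padded_space_metric.

(** The first [L.+1 ^ k] points enumerate the grid; each surplus point duplicates the origin, which
    [sup_distn] tolerates. *)
Lemma grid_coding (N k L : nat) : (L.+1 ^ k <= N)%N ->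
  exists phi : 'I_N -> 'I_k -> nat,
  forall g : 'I_k -> nat, (forall i, g i <= L)%N -> exists x, phi x =1 g.
Proof.
move=> LN; pose F := {ffun 'I_k -> 'I_L.+1}.
have cardF : (#|F| <= N)%N by rewrite card_ffun !card_ord.
exists (fun x i => nth [ffun=> ord0] (enum F) x i) => g gL.
pose g' : F := [ffun i => inord (g i)].
exists (widen_ord cardF (enum_rank g')) => i /=.
by rewrite nth_enum_rank ffunE inordK// ltnS.
Qed.

(** * Balls and truncated distances in a graph *)

Section truncated_distance.
Local Open Scope nat_scope.
Context {n : nat} (G : graph n).
Implicit Types A : {set 'I_n}.

Definition closed_nbhd (A : {set 'I_n}) : {set 'I_n} :=
  (A :|: \bigcup_(v in A) [set u | [set v; u] \in G])%SET.

Definition ball_around (A : {set 'I_n}) j := iter j closed_nbhd A.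

(** Counting the radii below [l] whose ball misses [v] gives the minimum of [l] and the graph
    distance to [A], because the balls are nested; an infinite distance gives [l]. *)
Definition trunc_dist (A : {set 'I_n}) l (v : 'I_n) : nat :=
  \sum_(j < l) (v \notin ball_around A j).

Lemma ball_around_mono A i j : i <= j -> ball_around A i \subset ball_around A j.
Proof.
move=> /subnK <-; elim: (j - i) => // m IH.
by rewrite addSn (fintype.subset_trans IH)// finset.subsetUl.
Qed.

Lemma card_neighbours (v : 'I_n) :
  #|[set u | [set v; u] \in G]%SET| <= degree G v.
Proof.
have inj : injective (fun u : 'I_n => [set v; u]%SET).
  move=> u w /= uw; have := set22 v u; rewrite uw !inE.
  have := set22 v w; rewrite -uw !inE.
  by case/orP => /eqP -> // /orP[] /eqP ->.
rewrite -(card_imset _ inj); apply: subset_leq_card.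
by apply/fintype.subsetP => _ /imsetP[u + ->]; rewrite !inE => ->; rewrite eqxx.
Qed.

Lemma card_closed_nbhd d A : regular d G -> #|closed_nbhd A| <= #|A| * d.+1.
Proof.
move=> Greg; rewrite mulnS (leq_trans (leq_card_setU _ _))// leq_add2l.
have -> : #|A| * d = \sum_(v in A) d by rewrite sum_nat_const.
elim/big_rec2 : _ => [|v B m vA IH]; first by rewrite cards0.
rewrite (leq_trans (leq_card_setU _ _))// leq_add//.
by rewrite (leq_trans (card_neighbours v))// (eqP (forallP Greg v)).
Qed.

Lemma card_ball_around d A j : regular d G ->
  #|ball_around A j| <= #|A| * d.+1 ^ j.
Proof.
move=> Greg; elim: j => [|j IH]; first by rewrite muln1.
by rewrite (leq_trans (card_closed_nbhd d _ Greg))// expnSr mulnA leq_mul2r IH orbT.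
Qed.

Lemma trunc_dist_le A l v : trunc_dist A l v <= l.
Proof.
rewrite -[leqRHS]card_ord -sum1_card; apply: leq_sum => j _; exact: leq_b1.
Qed.

Lemma trunc_dist0 A l v : v \in A -> trunc_dist A l v = 0.
Proof.
move=> vA; rewrite /trunc_dist big1// => j _.
by rewrite (fintype.subsetP (ball_around_mono A 0 j _) v vA).
Qed.

Lemma trunc_dist_max A l v : v \notin ball_around A l -> trunc_dist A l v = l.
Proof.
move=> vA; rewrite -[RHS]card_ord -sum1_card; apply: eq_bigr => j _.
have /fintype.subsetP/(_ v) := ball_around_mono A j l (ltnW (ltn_ord j)).
by case: (v \in _) => // /(_ isT) vB; rewrite vB in vA.
Qed.

Lemma trunc_dist_lip A l v u : [set v; u]%SET \in G ->
  trunc_dist A l u <= (trunc_dist A l v).+1.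
Proof.
move=> vuG; case: l => [|l]; first by rewrite /trunc_dist big_ord0.
(* Radius [0] for [u] costs at most 1; radius [j.+1] for [u] is compared with radius [j] for [v],
   and the last term for [v] is dropped. *)
rewrite /trunc_dist big_ord_recl big_ord_recr.
rewrite -[leqRHS]add1n leq_add ?leq_b1//.
apply: leq_trans (leq_addr _ _); apply: leq_sum => j _.
rewrite lift0; case: (boolP (v \in _)) => [vB|_]; last exact: leq_b1.
rewrite -[ball_around A j.+1]/(closed_nbhd (ball_around A j)).
suff -> : u \in closed_nbhd (ball_around A j) by [].
by rewrite inE; apply/orP; right; apply/bigcupP; exists v => //; rewrite inE.
Qed.

End truncated_distance.

(** On a residue class the quotient by [k] is injective, with values at most [n %/ k]. *)
Lemma card_residue_class (n k r : nat) : (0 < k)%N ->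
  (#|[set u : 'I_n | (u %% k)%N == r]%SET| <= n %/ k + 1)%N.
Proof.
move=> k0; rewrite addn1; pose q (u : 'I_n) : 'I_(n %/ k).+1 := inord (u %/ k).
have qE (u : 'I_n) : q u = (u %/ k)%N :> nat.
  rewrite /q inordK// ltnS; apply: leq_div2r; exact: ltnW.
rewrite -[leqRHS]card_ord -(card_in_imset (f := q)) ?max_card//.
move=> u v; rewrite !inE => /eqP ur /eqP vr /(congr1 val); rewrite /= !qE => uv.
by apply/val_inj; rewrite /= (divn_eq u k) (divn_eq v k) uv ur vr.
Qed.

(** * Lower bounds on the Poincaré constant from a single test map *)

Section poincare_lower_bound.
Context {R : realType} {n : nat}.
Variables (G : graph n) (M : metricType R) (f : 'I_n -> M).

Lemma edge_dist_sum_le :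
  (forall v u, [set v; u]%SET \in G -> mdist (f v) (f u) <= 1) ->
  edge_dist_sum G f <= #|G|%:R.
Proof.
move=> lip; pose E : {set 'I_n * 'I_n} :=
  [set p : 'I_n * 'I_n | (p.1 < p.2)%N && ([set p.1; p.2]%SET \in G)]%SET.
have -> : edge_dist_sum G f = \sum_(p in E) mdist (f p.1) (f p.2).
  by apply: eq_bigl => p; rewrite inE.
apply: (@le_trans _ _ (\sum_(p in E) 1)).
  by apply: ler_sum => -[v u]; rewrite inE => /andP[_ /lip].
rewrite sumr_const ler_nat.
(* An ordered pair with [p.1 < p.2] is determined by its edge, so there are at most [#|G|] terms. *)
rewrite -(card_in_imset (f := fun p : 'I_n * 'I_n => [set p.1; p.2]%SET)).
  apply/subset_leq_card/fintype.subsetP => _ /imsetP[p + ->].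
  by rewrite inE => /andP[].
move=> [a b] [a' b']; rewrite !inE /= => /andP[ab _] /andP[ab' _] e.
have := set21 a b; have := set22 a b; rewrite {1 2}e !inE.
have := set21 a' b'; have := set22 a' b'; rewrite -{1 2}e !inE.
move: ab ab'; rewrite -!(inj_eq val_inj) /= => ab ab' h1 h2 h3 h4.
by congr pair; apply/val_inj => /=; lia.
Qed.

Lemma mean_dist_ge (l : R) : (0 < n)%N -> 0 <= l ->
  (forall v, n <= 4 * #|[set u | (l <= mdist (f v) (f u))%R]%SET|)%N ->
  l / 4 <= mean_dist f.
Proof.
move=> n0 l0 far; rewrite /mean_dist ler_pdivlMl ?exprn_gt0 ?ltr0n//.
have -> : n%:R ^+ 2 * (l / 4) = \sum_(v < n) (n%:R * (l / 4)).
  by rewrite sumr_const card_ord -[RHS]mulr_natl [RHS]mulrA -expr2.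
apply: ler_sum => v _; set A := [set u | (l <= mdist (f v) (f u))%R]%SET.
apply: (@le_trans _ _ (\sum_(u in A) l)).
  have : (n%:R : R) <= 4 * #|A|%:R by rewrite -natrM ler_nat far.
  by rewrite sumr_const -mulr_natl; nra.
rewrite [leRHS](bigID (mem A)) /= ler_wpDr//.
  by apply: sumr_ge0 => u _; exact: mdist_ge0.
by apply: ler_sum => u; rewrite inE.
Qed.

Lemma poincare_gamma_ge (l : R) : (0 < n)%N -> 0 <= l ->
  (forall v u, [set v; u]%SET \in G -> mdist (f v) (f u) <= 1) ->
  (forall v, n <= 4 * #|[set u | (l <= mdist (f v) (f u))%R]%SET|)%N ->
  ((l / 4)%:E <= poincare_gamma G M)%E.
Proof.
move=> n0 l0 lip far; apply: le_ereal_inf_tmp => _ [g [g0 gP] <-].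
rewrite lee_fin (le_trans (mean_dist_ge _ _ _ _))// (le_trans (gP f))//.
rewrite -mulrA ler_piMr ?(ltW g0)//.
(* Without edges the inverse of [#|G|] is 0 by convention, and the factor of [g] is still at most
   1. *)
have [->|G0] := eqVneq #|G| 0%N; first by rewrite invr0 mul0r ler01.
by rewrite ler_pdivrMl ?ltr0n ?lt0n// mulr1 edge_dist_sum_le.
Qed.

End poincare_lower_bound.

(** * The two test maps: into the grid and into a discrete space *)

Lemma gamma_grid_ge (R : realType) (n d N k l L : nat)
    (phi : 'I_N -> 'I_k -> nat) (G : graph n) :
  (forall g : 'I_k -> nat, (forall i, g i <= L)%N -> exists x, phi x =1 g) ->
  (0 < n)%N -> (0 < k)%N -> (l <= L)%N ->
  (4 * d.+1 ^ l <= k)%N -> (4 * d.+1 ^ l <= n)%N -> regular d G ->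
  ((l%:R / 4)%:E <= poincare_gamma G (padded_space R N _ phi))%E.
Proof.
move=> code n0 k0 lL lk ln Greg.
pose S (i : 'I_k) := [set u : 'I_n | (u %% k)%N == i]%SET.
have /choice[f fE] : forall v : 'I_n, exists x : 'I_N,
    phi x =1 fun i => trunc_dist G (S i) l v.
  by move=> v; apply: code => i; rewrite (leq_trans (trunc_dist_le _ _ _ _)).
apply: (@poincare_gamma_ge _ _ _ (padded_space R N _ phi) f) => // [v u vu|v].
  rewrite mdist_padded (_ : 1 = 1%:R)// ler_nat sup_distn_le1// => i.
  rewrite !fE; have := trunc_dist_lip G (S i) l _ _ vu.
  have uv : [set u; v]%SET \in G by rewrite finset.setUC.
  have := trunc_dist_lip G (S i) l _ _ uv; lia.
(* The coordinate of the class of [v] alone suffices: it is 0 at [v] and [l] at every vertex outside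
   the ball around that class. *)
pose i : 'I_k := Ordinal (ltn_pmod v k0).
have vS : v \in S i by rewrite inE.
apply: (@leq_trans (4 * #|~: ball_around G (S i) l|%SET)); last first.
  rewrite leq_mul2l; apply: subset_leq_card.
  apply/fintype.subsetP => u; rewrite !inE => uB.
  rewrite mdist_padded ler_nat (leq_trans _ (leq_sup_distn _ _ _ i))//.
  by rewrite !fE trunc_dist0// trunc_dist_max//; lia.
have := card_ball_around G d (S i) l Greg.
have := card_residue_class n k i k0.
have := cardsC (ball_around G (S i) l); rewrite card_ord.
have : (n %/ k * (4 * d.+1 ^ l) <= n)%N.
  by apply: leq_trans (leq_trunc_div n k); rewrite leq_mul2l lk orbT.
(* The ball has at most [q * a + a] vertices. Each summand is at most [n / 4], by [4 * a <= k] and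
   [4 * a <= n], so at least half of the vertices lie outside. *)
rewrite -/(S i); set s := #|S i|; set a := (d.+1 ^ l)%N; set q := (n %/ k)%N.
move=> h1 h2 h3 h4.
have : (s * a <= (q + 1) * a)%N by rewrite leq_mul2r h3 orbT.
rewrite mulnDl mul1n; rewrite mulnCA in h1.
move: ln h1 h2 h4; rewrite -/a.
move: (s * a)%N (q * a)%N => sa qa; lia.
Qed.

(** With no coordinates, distinct points are at distance 1. The vertices are split by parity; a
    class has at most [n %/ 2 + 1] of them, which leaves a quarter outside once [4 <= n]. *)
Lemma gamma_discrete_ge (R : realType) (n N : nat)
    (phi : 'I_N -> 'I_0 -> nat) (G : graph n) :
  (1 < N)%N -> (4 <= n)%N ->
  ((1 / 4)%:E <= poincare_gamma G (padded_space R N _ phi))%E.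
Proof.
move=> N1 n4.
have parityN (v : 'I_n) : (v %% 2 < N)%N by rewrite (leq_trans _ N1)// ltn_pmod.
pose f (v : 'I_n) : padded_space R N _ phi := Ordinal (parityN v).
apply: (@poincare_gamma_ge _ _ _ _ f) => // [|v u _|v]; first by lia.
  by rewrite mdist_padded (_ : 1 = 1%:R)// ler_nat sup_distn_le1// => -[].
pose S := [set u : 'I_n | (u %% 2)%N == (v %% 2)%N]%SET.
apply: (@leq_trans (4 * #|~: S|%SET)); last first.
  rewrite leq_mul2l; apply: subset_leq_card.
  apply/fintype.subsetP => u; rewrite !inE => uv.
  rewrite mdist_padded (_ : 1 = 1%:R)// ler_nat sup_distn_gt0//.
  by rewrite -(inj_eq val_inj) /= eq_sym.
have := card_residue_class n 2 (v %% 2) isT.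
rewrite -/S; have := cardsC S; rewrite card_ord.
lia.
Qed.

(** * Choice of the parameters and comparison with logarithms *)

Section parameters.
Local Open Scope nat_scope.

(** [L] is the largest level whose grid fits into [N] points. Failure at [L.+1] bounds [N], using
    [L.+2 <= 2 ^ L.+1] and [4 * L.+1 <= 4 ^ L.+1 <= K ^ L.+1]. *)
Lemma max_grid_level (K N : nat) : 4 <= K -> 0 < N ->
  exists L, L.+1 ^ (4 * K ^ L) <= N /\ N <= 2 ^ (K ^ (2 * L.+1)).
Proof.
move=> K4 N0; pose P L := L.+1 ^ (4 * K ^ L) <= N.
have P0 : exists L, P L by exists 0; rewrite /P exp1n.
have PN L : P L -> L <= N.
  move=> PL; rewrite ltnW// (leq_trans _ PL)// -{1}[L.+1]expn1 leq_pexp2l//.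
  by rewrite muln_gt0 expn_gt0 (leq_trans _ K4).
case: (ex_maxnP P0 PN) => L PL maxL; exists L; split=> //.
have : ~~ P L.+1 by apply/negP => /maxL; rewrite ltnn.
rewrite /P -ltnNge => /ltnW /leq_trans; apply.
apply: (@leq_trans ((2 ^ L.+1) ^ (4 * K ^ L.+1))).
  have e0 : 0 < 4 * K ^ L.+1 by rewrite muln_gt0 expn_gt0 (leq_trans _ K4).
  by rewrite (leq_exp2r _ _ e0); exact: (ltn_expl L.+1 (isT : 1 < 2)).
rewrite -expnM leq_pexp2l// mul2n -addnn expnD mulnA leq_mul//.
rewrite mulnC (@leq_trans (4 ^ L.+1))//; last by rewrite leq_exp2r.
by rewrite expnS leq_mul//; exact: (ltn_expl L (isT : 1 < 4)).
Qed.

Lemma max_radius (K n : nat) : 4 <= K -> 4 * K <= n ->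
  exists l, [/\ 0 < l, 4 * K ^ l <= n & n <= K ^ (2 * l.+1)].
Proof.
move=> K4 Kn; have K1 : 1 < K by lia.
have n4 : 0 < n %/ 4 by lia.
(* Maximality of [l] gives [n < 4 * K ^ l.+1], and the factor 4 is absorbed into one more power of
   [K]. *)
exists (trunc_log K (n %/ 4)); have [lo hi] := andP (trunc_log_bounds K1 n4).
split; first by rewrite trunc_log_gt0; lia.
  by move: lo; lia.
rewrite (@leq_trans (K * K ^ (trunc_log K (n %/ 4)).+1))//.
  by move: hi; set a := _ ^ _; nia.
by rewrite -expnS leq_pexp2l//; lia.
Qed.

End parameters.

Section logarithms.
Context {R : realType}.

Lemma ln_le_log (K m n : nat) : (0 < K)%N -> (0 < n)%N -> (n <= K ^ m)%N ->
  ln (n%:R : R) <= m%:R * ln K%:R.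
Proof.
move=> K0 n0 nK; rewrite mulr_natl -lnXn ?ltr0n//.
by rewrite ler_ln ?posrE ?exprn_gt0 ?ltr0n// -natrX ler_nat.
Qed.

Lemma lnln_le_log (K m N : nat) : (0 < K)%N -> (1 < N)%N ->
  (N <= 2 ^ (K ^ m))%N -> ln (ln (N%:R : R)) <= m%:R * ln K%:R.
Proof.
move=> K0 N1 NK; have N0 : (0 < N)%N by lia.
(* The inner logarithm is at most [K ^ m * ln 2], and this lets the factor [ln 2] be dropped. *)
have ln2 : ln (2%:R : R) <= 1.
  have := @le_ln1Dx R 1; rewrite -[1 + 1]/(2%:R); apply; lra.
rewrite mulr_natl -lnXn ?ltr0n// ler_ln ?posrE ?exprn_gt0 ?ltr0n//; last first.
  by rewrite ln_gt0// ltr1n.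
rewrite (le_trans (ln_le_log 2 (K ^ m) N _ _ _))//.
by rewrite -natrX ler_piMr.
Qed.

End logarithms.

Theorem proposition11p1 (R : realType) (d : nat) (hd : (3 <= d)%N) :
  exists c tau B : R, [/\ 0 < c, 0 < tau, 0 < B &
    forall N : nat, (3 <= N)%N ->
    exists M : metricType R, ([set: M] #= `I_N)%card /\
    forall n : nat, (d <= n)%N -> ~~ odd (d * n)%N ->
      (0 < #|regular_graphs n d|)%N ->
      1 - B / (n%:R `^ tau) <=
      regular_graph_prob R d
        [set G : graph n |
          ((c * Num.min (ln n%:R) (ln (ln N%:R)))%:E <= poincare_gamma G M)%E]%SET].
Proof.
have lnK0 : 0 < ln (d.+1%:R : R) by rewrite ln_gt0// ltr1n; lia.
(* Both logarithms get bounds of the form [2 * m.+1 * ln d.+1], which [c] turns into [m.+1 / 8]: at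
   most [m / 4] for [m >= 1], and at most the discrete bound [1 / 4] for [m = 0]. *)
pose c : R := (16 * ln d.+1%:R)^-1.
have c0 : 0 < c by rewrite invr_gt0 mulr_gt0.
have cE (m : nat) : c * ((2 * m.+1)%:R * ln d.+1%:R) = m.+1%:R / 8.
  by rewrite /c natrM; field; rewrite gt_eqF.
exists c, 1, (4 * d.+1)%:R; split; rewrite ?ltr0n ?muln_gt0// => N N3.
have almost_sure (M : metricType R) :
    (forall n (G : graph n), (4 * d.+1 <= n)%N -> regular d G ->
      ((c * Num.min (ln n%:R) (ln (ln N%:R)))%:E <= poincare_gamma G M)%E) ->
    forall n : nat, (d <= n)%N -> ~~ odd (d * n)%N ->
      (0 < #|regular_graphs n d|)%N ->
      1 - (4 * d.+1)%:R / (n%:R `^ 1) <=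
      regular_graph_prob R d
        [set G : graph n |
          ((c * Num.min (ln n%:R) (ln (ln N%:R)))%:E <= poincare_gamma G M)%E]%SET.
  move=> HM n dn _ G0; rewrite powRr1//.
  have n0 : (0 < n)%N by lia.
  have [big|small] := leqP (4 * d.+1) n.
    rewrite /regular_graph_prob (finset.setIidPr _).
      by rewrite divff ?pnatr_eq0 -?lt0n// gerBl divr_ge0.
    by apply/fintype.subsetP => G; rewrite !inE => /andP[_ Greg]; exact: HM.
  apply: (@le_trans _ _ 0); last by rewrite divr_ge0.
  by rewrite subr_le0 ler_pdivlMr ?ltr0n// mul1r ler_nat ltnW.
have [|//|L [codeL NL]] := max_grid_level d.+1 N; [by lia|by lia|].
have lnlnN : ln (ln (N%:R : R)) <= (2 * L.+1)%:R * ln d.+1%:R.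
  by apply: lnln_le_log => //; lia.
have card_padded k (phi : 'I_N -> 'I_k -> nat) :
    ([set: padded_space R N _ phi] #= `I_N)%card.
  by rewrite card_eq_sym; exact: card_II.
case: (posnP L) => [L0|L0].
  pose phi : 'I_N -> 'I_0 -> nat := fun _ _ => 0%N.
  exists (padded_space R N _ phi); split; first exact: card_padded.
  apply: almost_sure => n G n4 _.
  apply: le_trans (gamma_discrete_ge _ _ _ _ _ _ _); [|lia|lia].
  rewrite lee_fin (@le_trans _ _ (c * ((2 * L.+1)%:R * ln d.+1%:R)))//.
    by rewrite ler_pM2l// ge_min lnlnN orbT.
  by rewrite cE L0; lra.
have [phi code] := grid_coding _ _ _ codeL.
exists (padded_space R N _ phi); split; first exact: card_padded.
apply: almost_sure => n G n4 Greg.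
have [|//|l [l0 le_ln nl]] := max_radius d.+1 n; first by lia.
(* The space depends on [L] only, while the radius may depend on [n]. Whichever of [l] and [L]
   attains the minimum bounds the matching logarithm. *)
pose m := minn l L.
have m0 : (0 < m)%N by rewrite leq_min l0 L0.
have Km (j : nat) : (m <= j)%N -> (4 * d.+1 ^ m <= 4 * d.+1 ^ j)%N.
  by move=> mj; rewrite leq_mul2l leq_pexp2l.
apply: le_trans (@gamma_grid_ge R n d N _ m L phi G code _ _ _ _ _ Greg).
- rewrite lee_fin (@le_trans _ _ (c * ((2 * m.+1)%:R * ln d.+1%:R)))//.
    rewrite ler_pM2l// ge_min /m; case: (leqP l L) => _.
      by rewrite ln_le_log//; lia.
    by rewrite lnlnN orbT.
  rewrite cE; have : (m.+1%:R : R) <= (2 * m)%:R by rewrite ler_nat; lia.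
  by rewrite natrM; lra.
- by lia.
- by rewrite muln_gt0 expn_gt0.
- exact: geq_minr.
- by apply: Km; exact: geq_minr.
- by apply: leq_trans le_ln; apply: Km; exact: geq_minl.
Qed.
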